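(* Let $\beta>0$ be a constant. For every $\omega\in(0,\beta)$, the stationary equation $$ (\mathcal{D}+\beta\sigma_3-\omega)\Phi(x)=G(\Phi(x))\Phi(x),\qquad x\in\mathbb{R}, $$ admits a smooth solution of the form $\Phi=(u,iv)$, with $u,v$ real-valued, which decays exponentially at infinity: $$ |\Phi(x)|=\sqrt{u^2(x)+v^2(x)}\le Ce^{-\sqrt{\beta^2-\omega^2}\,|x|},\qquad\forall x\in\mathbb{R}, $$ for some constant $C=C(\beta,\omega)>0$.
   Context: $\mathcal{D}=-i\begin{pmatrix}0&\partial_x\\ \partial_x&0\end{pmatrix}$ is the one-dimensional Dirac operator acting on $\mathbb{C}^2$-valued functions on $\mathbb{R}$, $\sigma_3=\begin{pmatrix}1&0\\0&-1\end{pmatrix}$, and $G(\Phi)=\begin{pmatrix}|\Phi^1|^2&0\\0&|\Phi^2|^2\end{pmatrix}$ for $\Phi=(\Phi^1,\Phi^2)^T$. *)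

(* Defs.v *)
(* Stdlib real numbers and Coquelicot (complex numbers, matrices, derivatives). *)
From Stdlib Require Import Reals.
From Coquelicot Require Export Coquelicot.
Open Scope R_scope.

Definition mat2 := @matrix C 2 2.
Definition spinor := @matrix C 2 1.

Definition mk2 (a b c d : C) : mat2 := [ [ a, b ], [ c, d ] ].
Definition col2 (a b : C) : spinor := [ [ a ], [ b ] ].
Definition mul (A : mat2) (z : spinor) : spinor := @Mmult C_Ring 2 2 1 A z.
Definition mscal {m n : nat} (c : C) (A : @matrix C m n) : @matrix C m n :=
  mk_matrix m n (fun i j => (c * coeff_mat (RtoC 0) A i j)%C).

Definition comp1 (z : spinor) : C := coeff_mat (RtoC 0) z 0 0.
Definition comp2 (z : spinor) : C := coeff_mat (RtoC 0) z 1 0.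

Definition spinor_norm (z : spinor) : R :=
  sqrt (Cmod (comp1 z) ^ 2 + Cmod (comp2 z) ^ 2).

(* Derivative of a complex-valued function of a real variable.  [Derive] is
   total, so this is meaningful only for differentiable functions. *)
Definition CDerive (f : R -> C) (x : R) : C :=
  (Derive (fun t => Re (f t)) x, Derive (fun t => Im (f t)) x).

Definition smoothR (f : R -> R) : Prop :=
  forall (n : nat) (x : R), ex_derive_n f n x.
Definition smoothC (f : R -> C) : Prop :=
  smoothR (fun t => Re (f t)) /\ smoothR (fun t => Im (f t)).
Definition smooth (Phi : R -> spinor) : Prop :=
  smoothC (fun t => comp1 (Phi t)) /\ smoothC (fun t => comp2 (Phi t)).

(* -i times the matrix with zero diagonal and off-diagonal entries d/dx. *)
Definition Dirac (Phi : R -> spinor) (x : R) : spinor :=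
  mscal (- Ci)%C (col2 (CDerive (fun t => comp2 (Phi t)) x)
                       (CDerive (fun t => comp1 (Phi t)) x)).

Definition sigma3 : mat2 := mk2 (RtoC 1) (RtoC 0) (RtoC 0) (RtoC (-1)).

Definition G (z : spinor) : mat2 :=
  mk2 (RtoC (Cmod (comp1 z) ^ 2)) (RtoC 0)
      (RtoC 0) (RtoC (Cmod (comp2 z) ^ 2)).

Definition stationary_op (beta omega : R) (Phi : R -> spinor) (x : R) : spinor :=
  @minus (@matrix_AbelianGroup C_AbelianGroup 2 1)
    (@plus (@matrix_AbelianMonoid C_AbelianMonoid 2 1)
       (Dirac Phi x) (mul (mscal (RtoC beta) sigma3) (Phi x)))
    (mscal (RtoC omega) (Phi x)).

Definition stationary_solution (beta omega : R) (Phi : R -> spinor) : Prop :=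
  forall x : R, stationary_op beta omega Phi x = mul (G (Phi x)) (Phi x).

(* Main.v *)
Require Import Defs.
From Stdlib Require Import Reals.
From Coquelicot Require Import Coquelicot.
From Stdlib Require Import Lra Psatz.
Open Scope R_scope.

(** For [Phi = (u, i v)] the equation is the planar Hamiltonian system
    [u' = - (beta + omega) v - v^3], [v' = u^3 - (beta - omega) u].  On the zero
    energy level, polar coordinates [u = r cos t], [v = r sin t] decouple it:
    [t' = beta cos (2 t) - omega], so [tan t = m tanh (k x)] with
    [m^2 = (beta - omega) / (beta + omega)] and [k^2 = beta^2 - omega^2], while
    the energy gives [r] as a function of [t].  The homoclinic orbit is then
    explicit ([soliton_u], [soliton_v], where [p = beta + omega], so that
    [beta - omega = m^2 p] and [k = m p]).  Smoothness follows from the system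
    itself: polynomials in [u] and [v] are closed under differentiation. *)

(** * Smoothness from closure under differentiation *)

(** By induction every iterated derivative agrees pointwise with a member of [P], and each member of
    [P] is differentiable. *)
Lemma smoothR_of_derivation_closed (P : (R -> R) -> Prop) :
  (forall f, P f -> exists g, P g /\ forall x, is_derive f x (g x)) ->
  forall f, P f -> smoothR f.
Proof.
  intros HP f Pf.
  assert (H : forall n, exists g, P g /\ forall x, Derive_n f n x = g x).
  { induction n as [|n [g [Pg Hg]]].
    - exists f; split; [exact Pf | reflexivity].
    - destruct (HP g Pg) as [h [Ph Hh]].
      exists h; split; [exact Ph |].
      intro x; simpl.
      rewrite (Derive_ext _ g x Hg).
      now apply is_derive_unique. }
  intros [|n] x; simpl; [exact I |].
  destruct (H n) as [g [Pg Hg]].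
  destruct (HP g Pg) as [h [_ Hh]].
  apply ex_derive_ext with g; [now intro; rewrite Hg | now exists (h x)].
Qed.

Inductive poly2 (u v : R -> R) : (R -> R) -> Prop :=
| poly2_const c : poly2 u v (fun _ => c)
| poly2_fst : poly2 u v u
| poly2_snd : poly2 u v v
| poly2_plus f g : poly2 u v f -> poly2 u v g -> poly2 u v (fun x => f x + g x)
| poly2_mult f g : poly2 u v f -> poly2 u v g -> poly2 u v (fun x => f x * g x).

(** Serves the vanishing imaginary part of [u] and real part of [i v]. *)
Lemma smoothR_const (c : R) : smoothR (fun _ => c).
Proof.
  apply (smoothR_of_derivation_closed (fun f => exists c, f = fun _ => c));
    [| now exists c].
  intros f [d ->]; exists (fun _ => 0); split; [now exists 0 |].
  intro x; auto_derive; auto.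
Qed.

(** Since [du] and [dv] are polynomials in [u] and [v], the sum and Leibniz rules keep derivatives
    inside [poly2 u v]. *)
Lemma poly2_smoothR (u v du dv : R -> R) :
  poly2 u v du -> poly2 u v dv ->
  (forall x, is_derive u x (du x)) -> (forall x, is_derive v x (dv x)) ->
  forall f, poly2 u v f -> smoothR f.
Proof.
  intros Pdu Pdv Hu Hv.
  apply smoothR_of_derivation_closed.
  intros f Pf.
  induction Pf as [c | | | f g Pf [f' [Pf' Hf]] Pg [g' [Pg' Hg]]
                  | f g Pf [f' [Pf' Hf]] Pg [g' [Pg' Hg]]].
  - exists (fun _ => 0); split; [constructor |].
    intro x; auto_derive; auto.
  - now exists du.
  - now exists dv.
  - exists (fun x => f' x + g' x); split; [now constructor |].
    intro x; now apply (is_derive_plus (K := R_AbsRing) (V := R_NormedModule)).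
  - exists (fun x => f' x * g x + f x * g' x); split.
    + now constructor; constructor.
    + intro x; apply (is_derive_mult f g x (f' x) (g' x)); auto.
      intros; apply Rmult_comm.
Qed.

(** * Hyperbolic functions *)

Lemma is_derive_cosh_scal (k x : R) :
  is_derive (fun y => cosh (k * y)) x (k * sinh (k * x)).
Proof. unfold cosh, sinh; auto_derive; [auto | field]. Qed.

Lemma is_derive_sinh_scal (k x : R) :
  is_derive (fun y => sinh (k * y)) x (k * cosh (k * x)).
Proof. unfold cosh, sinh; auto_derive; [auto | field]. Qed.

Lemma cosh_pos (x : R) : 0 < cosh x.
Proof. unfold cosh; pose proof (exp_pos x); pose proof (exp_pos (- x)); lra. Qed.

Lemma cosh_sqr (x : R) : cosh x ^ 2 = 1 + sinh x ^ 2.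
Proof.
  assert (H : exp x * exp (- x) = 1)
    by (rewrite <- exp_plus, Rplus_opp_r; apply exp_0).
  unfold cosh, sinh; nra.
Qed.

Lemma exp_Rabs_le_cosh (x : R) : exp (Rabs x) <= 2 * cosh x.
Proof.
  pose proof (exp_pos x); pose proof (exp_pos (- x)).
  unfold cosh, Rabs; destruct (Rcase_abs x); lra.
Qed.

(** * The explicit homoclinic orbit *)

Section Soliton.

Variables m p : R.
Hypotheses (m_pos : 0 < m) (p_pos : 0 < p).

Let c (x : R) : R := cosh (m * p * x).
Let s (x : R) : R := sinh (m * p * x).

(** The angle formula makes [(u, v)] proportional to [(c, m s)]. Zero energy reads
    [u^4 + v^4 = 2 p (m^2 u^2 - v^2)]; with [c^2 - s^2 = 1] the squared scale is
    [2 m^2 p / (c^4 + m^4 s^4)]. Its numerator is the square of [amplitude], and the root of the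
    rest is this weight. *)
Definition quartic_weight (x : R) : R := / sqrt (c x ^ 4 + m ^ 4 * s x ^ 4).
Definition amplitude : R := m * sqrt (2 * p).
Definition soliton_u (x : R) : R := amplitude * c x * quartic_weight x.
Definition soliton_v (x : R) : R := amplitude * m * s x * quartic_weight x.

Lemma quartic_ge (x : R) : c x ^ 4 <= c x ^ 4 + m ^ 4 * s x ^ 4.
Proof.
  assert (0 <= (m ^ 2 * s x ^ 2) ^ 2) by apply pow2_ge_0.
  nra.
Qed.

Lemma quartic_pos (x : R) : 0 < c x ^ 4 + m ^ 4 * s x ^ 4.
Proof.
  apply Rlt_le_trans with (2 := quartic_ge x).
  apply pow_lt, cosh_pos.
Qed.

Lemma quartic_weight_sqr (x : R) :
  (c x ^ 4 + m ^ 4 * s x ^ 4) * quartic_weight x ^ 2 = 1.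
Proof.
  unfold quartic_weight.
  rewrite pow_inv, pow2_sqrt by apply Rlt_le, quartic_pos.
  apply Rinv_r, Rgt_not_eq, quartic_pos.
Qed.

Lemma amplitude_pos : 0 < amplitude.
Proof. apply Rmult_lt_0_compat, sqrt_lt_R0; lra. Qed.

Lemma amplitude_sqr : amplitude ^ 2 = 2 * m ^ 2 * p.
Proof. unfold amplitude; rewrite Rpow_mult_distr, pow2_sqrt; lra. Qed.

(** Chain rule for [q^(-1/2)], whose derivative is [- q' w^3 / 2], with
    [q' = 4 m p c s (c^2 + m^4 s^2)]. *)
Lemma is_derive_quartic_weight (x : R) :
  is_derive quartic_weight x
    (- 2 * (m * p) * c x * s x * (c x ^ 2 + m ^ 4 * s x ^ 2) * quartic_weight x ^ 3).
Proof.
  pose proof (quartic_pos x) as Hq.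
  pose proof (sqrt_lt_R0 _ Hq) as Hr.
  unfold quartic_weight.
  auto_derive.
  - repeat split; try exact Hq; try lra.
    + exists (m * p * s x); apply is_derive_cosh_scal.
    + exists (m * p * c x); apply is_derive_sinh_scal.
  - now apply Rgt_not_eq.
  - change (Derive (fun y : R => c y) x) with (Derive c x).
    change (Derive (fun y : R => s y) x) with (Derive s x).
    rewrite (is_derive_unique c x _ (is_derive_cosh_scal (m * p) x)).
    rewrite (is_derive_unique s x _ (is_derive_sinh_scal (m * p) x)).
    fold (c x) (s x).
    simpl pow in *.
    match goal with |- context [sqrt ?a] => set (q := sqrt a) in * end.
    field; lra.
Qed.

Lemma is_derive_soliton_u (x : R) :
  is_derive soliton_u x (- p * soliton_v x - soliton_v x ^ 3).
Proof.
  evar_last.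
  - apply (is_derive_mult (fun y => amplitude * c y) quartic_weight).
    + apply is_derive_scal, is_derive_cosh_scal.
    + apply is_derive_quartic_weight.
    + intros; apply Rmult_comm.
  - unfold soliton_v.
    fold (c x) (s x).
    pose proof (quartic_weight_sqr x) as Hw.
    pose proof (cosh_sqr (m * p * x)) as Hc.
    fold (c x) (s x) in Hc.
    set (w := quartic_weight x) in *.
    (* The explicit [1] is a handle: rewriting by [<- Hw] turns it into [(c^4 + m^4 s^4) w^2], after
       which [c^2 = 1 + s^2] closes the identity. *)
    transitivity (amplitude * m * s x * w * (p * 1
      - 2 * p * c x ^ 2 * (c x ^ 2 + m ^ 4 * s x ^ 2) * w ^ 2));
      [unfold plus, mult; simpl; ring |].
    transitivity (- amplitude * m * s x * w *
      (p * 1 + amplitude ^ 2 * m ^ 2 * s x ^ 2 * w ^ 2)); [| ring].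
    rewrite amplitude_sqr, <- Hw.
    replace (c x ^ 4) with ((c x ^ 2) ^ 2) by ring.
    rewrite Hc; ring.
Qed.

Lemma is_derive_soliton_v (x : R) :
  is_derive soliton_v x (soliton_u x ^ 3 - m ^ 2 * p * soliton_u x).
Proof.
  evar_last.
  - apply (is_derive_mult (fun y => amplitude * m * s y) quartic_weight).
    + apply is_derive_scal, is_derive_sinh_scal.
    + apply is_derive_quartic_weight.
    + intros; apply Rmult_comm.
  - unfold soliton_u.
    fold (c x) (s x).
    pose proof (quartic_weight_sqr x) as Hw.
    pose proof (cosh_sqr (m * p * x)) as Hc.
    fold (c x) (s x) in Hc.
    set (w := quartic_weight x) in *.
    transitivity (amplitude * c x * m ^ 2 * p * w * (1
      - 2 * s x ^ 2 * (c x ^ 2 + m ^ 4 * s x ^ 2) * w ^ 2));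
      [unfold plus, mult; simpl; ring |].
    transitivity (amplitude * c x * w *
      (amplitude ^ 2 * c x ^ 2 * w ^ 2 - m ^ 2 * p * 1)); [| ring].
    rewrite amplitude_sqr, <- Hw.
    replace (c x ^ 4) with ((c x ^ 2) ^ 2) by ring.
    rewrite Hc; ring.
Qed.

Lemma soliton_smooth (f : R -> R) : poly2 soliton_u soliton_v f -> smoothR f.
Proof.
  apply poly2_smoothR with
    (* Differences and powers are spelled as sums and products, the only operations [poly2]
       generates. *)
    (du := fun x => - p * soliton_v x
             + -1 * (soliton_v x * (soliton_v x * soliton_v x)))
    (dv := fun x => soliton_u x * (soliton_u x * soliton_u x)
             + - (m ^ 2 * p) * soliton_u x).
  - repeat constructor.
  - repeat constructor.
  - intro x; evar_last; [apply is_derive_soliton_u | simpl; ring].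
  - intro x; evar_last; [apply is_derive_soliton_v | simpl; ring].
Qed.

(** With [A] the amplitude, [m^2 s^2 <= c^2] gives [u^2 + v^2 <= 2 A^2 c^2 w^2]. Then [1 <= 2 c e]
    and [c^4 w^2 <= 1] give [c^2 w^2 <= 4 e^2], so the squared norm is at most [8 A^2 e^2], and 8 is
    rounded up to the square 9. *)
Lemma soliton_norm_le (x : R) : m <= 1 ->
  sqrt (soliton_u x ^ 2 + soliton_v x ^ 2)
    <= 3 * amplitude * exp (- (m * p) * Rabs x).
Proof.
  intro m_le1.
  pose proof amplitude_pos as HA.
  pose proof (exp_pos (- (m * p) * Rabs x)) as He.
  set (e := exp (- (m * p) * Rabs x)) in *.
  assert (Hec : 1 <= 2 * c x * e).
  { pose proof (exp_Rabs_le_cosh (m * p * x)) as H.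
    fold (c x) in H.
    rewrite Rabs_mult, (Rabs_pos_eq (m * p)) in H by nra.
    apply Rmult_le_compat_r with (r := e) in H; [| lra].
    unfold e in H at 1; rewrite <- exp_plus in H.
    now replace (m * p * Rabs x + - (m * p) * Rabs x) with 0 in H by ring;
      rewrite exp_0 in H. }
  rewrite <- (sqrt_pow2 (3 * amplitude * e)) by nra.
  apply sqrt_le_1_alt.
  pose proof (quartic_weight_sqr x) as Hw.
  pose proof (quartic_ge x) as Hq.
  pose proof (cosh_sqr (m * p * x)) as Hc; fold (c x) (s x) in Hc.
  pose proof (cosh_pos (m * p * x)) as Hcpos; fold (c x) in Hcpos.
  unfold soliton_u, soliton_v.
  set (w := quartic_weight x) in *.
  assert (Hms : m ^ 2 * s x ^ 2 <= c x ^ 2).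
  { assert (m ^ 2 <= 1) by nra.
    pose proof (pow2_ge_0 (s x)); nra. }
  assert (Hcw : (c x ^ 2 * w) ^ 2 <= 1).
  { rewrite <- Hw.
    replace ((c x ^ 2 * w) ^ 2) with (c x ^ 4 * w ^ 2) by ring.
    apply Rmult_le_compat_r; [apply pow2_ge_0 | exact Hq]. }
  assert (Hce : 1 <= (2 * c x * e) ^ 2) by nra.
  assert (Hw2 : 0 <= w ^ 2) by apply pow2_ge_0.
  assert (H1 : (c x ^ 2 + m ^ 2 * s x ^ 2) * w ^ 2 <= 2 * c x ^ 2 * w ^ 2) by nra.
  assert (H2 : c x ^ 2 * w ^ 2 * 1 <= c x ^ 2 * w ^ 2 * (2 * c x * e) ^ 2).
  { apply Rmult_le_compat_l; [| exact Hce].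
    apply Rmult_le_pos; [apply pow2_ge_0 | exact Hw2]. }
  assert (H3 : (c x ^ 2 * w) ^ 2 * e ^ 2 <= 1 * e ^ 2)
    by (apply Rmult_le_compat_r; [apply pow2_ge_0 | exact Hcw]).
  transitivity (amplitude ^ 2 * ((c x ^ 2 + m ^ 2 * s x ^ 2) * w ^ 2));
    [right; ring |].
  transitivity (amplitude ^ 2 * (9 * e ^ 2)); [| right; ring].
  apply Rmult_le_compat_l; [apply pow2_ge_0 | nra].
Qed.

(** Rules out the zero solution. *)
Lemma soliton_u_0 : 0 < soliton_u 0.
Proof.
  apply Rmult_lt_0_compat; [apply Rmult_lt_0_compat |].
  - apply amplitude_pos.
  - apply cosh_pos.
  - apply Rinv_0_lt_compat, sqrt_lt_R0, quartic_pos.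
Qed.

End Soliton.

(** * From the planar system to the spinor equation *)

Lemma Cmod_RtoC_sqr (a : R) : Cmod (RtoC a) ^ 2 = a ^ 2.
Proof. rewrite Cmod_R; apply pow2_abs. Qed.

Lemma Cmod_imag_sqr (b : R) : Cmod (0, b) ^ 2 = b ^ 2.
Proof.
  unfold Cmod; simpl fst; simpl snd.
  rewrite pow2_sqrt; [ring |].
  apply Rplus_le_le_0_compat; apply pow2_ge_0.
Qed.

(** As [-i (i v)' = v'], the first component is the real equation for [v']; the second is [-i] times
    the equation for [u']. *)
Lemma stationary_solution_of_system (beta omega : R) (u v : R -> R) :
  (forall x, is_derive u x (- (beta + omega) * v x - v x ^ 3)) ->
  (forall x, is_derive v x (u x ^ 3 - (beta - omega) * u x)) ->
  stationary_solution beta omega (fun x => col2 (RtoC (u x)) (0, v x)).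
Proof.
  intros Hu Hv x.
  pose proof (is_derive_unique _ _ _ (Hu x)) as Du.
  pose proof (is_derive_unique _ _ _ (Hv x)) as Dv.
  unfold stationary_op, Dirac, CDerive, G, comp1, comp2.
  change (coeff_mat (RtoC 0) (col2 (RtoC (u x)) (0, v x)) 0 0) with (RtoC (u x)).
  change (coeff_mat (RtoC 0) (col2 (RtoC (u x)) (0, v x)) 1 0) with ((0, v x) : C).
  change (fun t : R => Re (coeff_mat (RtoC 0) (col2 (RtoC (u t)) (0, v t)) 1 0))
    with (fun _ : R => 0).
  change (fun t : R => Im (coeff_mat (RtoC 0) (col2 (RtoC (u t)) (0, v t)) 1 0))
    with (fun t : R => v t).
  change (fun t : R => Re (coeff_mat (RtoC 0) (col2 (RtoC (u t)) (0, v t)) 0 0))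
    with (fun t : R => u t).
  change (fun t : R => Im (coeff_mat (RtoC 0) (col2 (RtoC (u t)) (0, v t)) 0 0))
    with (fun _ : R => 0).
  rewrite !Derive_const.
  change (fun t : R => v t) with v; change (fun t : R => u t) with u.
  rewrite Du, Dv.
  rewrite Cmod_RtoC_sqr, Cmod_imag_sqr.
  apply (coeff_mat_ext (RtoC 0)).
  (* Out-of-range indices yield the default entry on both sides; the two genuine entries are
     compared by real and imaginary parts. *)
  intros [|[|i]] [|j]; try reflexivity; apply injective_projections; cbn; ring.
Qed.

Theorem theorem4 (beta : R) (beta_pos : 0 < beta) :
  forall omega : R, 0 < omega < beta ->
  exists (Phi : R -> spinor) (u v : R -> R),
    smooth Phi /\
    stationary_solution beta omega Phi /\
    (forall x : R, Phi x = col2 (RtoC (u x)) (Ci * RtoC (v x))%C) /\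
    (exists x : R, Phi x <> col2 (RtoC 0) (RtoC 0)) /\
    exists K : R, 0 < K /\
      forall x : R,
        spinor_norm (Phi x) = sqrt (u x ^ 2 + v x ^ 2) /\
        sqrt (u x ^ 2 + v x ^ 2)
          <= K * exp (- sqrt (beta ^ 2 - omega ^ 2) * Rabs x).
Proof.
  intros omega Homega.
  set (p := beta + omega).
  set (m := sqrt ((beta - omega) / p)).
  assert (p_pos : 0 < p) by (unfold p; lra).
  assert (ratio_pos : 0 < (beta - omega) / p) by (apply Rdiv_lt_0_compat; lra).
  assert (m_pos : 0 < m) by now apply sqrt_lt_R0.
  assert (m_sqr : m ^ 2 * p = beta - omega)
    by (unfold m; rewrite pow2_sqrt; [field |]; lra).
  assert (m_le1 : m <= 1).
  { apply Rnot_lt_le; intro Hm.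
    (* If [m > 1], then [beta + omega < beta - omega], contradicting [0 < omega]. *)
    assert (1 * p < m ^ 2 * p) by (apply Rmult_lt_compat_r; nra).
    rewrite m_sqr in *; unfold p in *; lra. }
  assert (rate : sqrt (beta ^ 2 - omega ^ 2) = m * p).
  { rewrite <- (sqrt_pow2 (m * p)) by nra.
    replace ((m * p) ^ 2) with (m ^ 2 * p * p) by ring.
    rewrite m_sqr; f_equal; unfold p; ring. }
  pose (u := soliton_u m p); pose (v := soliton_v m p).
  (* The pair [(0, v x)] is [i v] in coordinates, which lets real and imaginary parts compute. *)
  exists (fun x => col2 (RtoC (u x)) (0, v x)), u, v.
  split; [split; split | split; [| split; [| split]]].
  - exact (soliton_smooth m p p_pos u (poly2_fst u v)).
  - exact (smoothR_const 0).
  - exact (smoothR_const 0).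
  - exact (soliton_smooth m p p_pos v (poly2_snd u v)).
  - apply stationary_solution_of_system.
    + now intro x; apply is_derive_soliton_u.
    + rewrite <- m_sqr; now intro x; apply is_derive_soliton_v.
  - intro x; apply (f_equal (col2 (RtoC (u x)))).
    apply injective_projections; cbn; ring.
  - exists 0; intro H.
    assert (H0 : u 0 = 0) by exact (f_equal (fun z => Re (comp1 z)) H).
    pose proof (soliton_u_0 m p) as Hu0.
    unfold u in H0; lra.
  - exists (3 * amplitude m p); split.
    + apply Rmult_lt_0_compat; [lra | now apply amplitude_pos].
    + intro x; split.
      * unfold spinor_norm.
        change (comp1 (col2 (RtoC (u x)) (0, v x))) with (RtoC (u x)).
        change (comp2 (col2 (RtoC (u x)) (0, v x))) with ((0, v x) : C).
        now rewrite Cmod_RtoC_sqr, Cmod_imag_sqr.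
      * rewrite rate; now apply soliton_norm_le.
Qed.
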